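(* Let $\mathcal{A}$ be an irreducible linear switching system in $\mathbb{R}^d$. Then every convex invariant set $M$ of $\mathcal{A}$ contains the origin. In this case, the origin can be either an interior point or a conical point of $M$.
   Context: A linear switching system in $\mathbb{R}^d$ is identified with its control set $\mathcal{A}$, a nonempty compact set of real $d\times d$ matrices. A switching law is a measurable function $A(\cdot):[0,\infty)\to\mathcal{A}$. A trajectory is an absolutely continuous function $x:[0,\infty)\to\mathbb{R}^d$ such that, for some switching law, $\dot x(t)=A(t)x(t)$ for almost every $t$. Standing assumption: $\mathcal{A}$ is convex and does not contain the zero matrix. For a compact set $K\subset\mathbb{R}^d$ and $t\ge 0$, $K_t$ denotes the set of points $x(t)$ over all trajectories with $x(0)\in K$. The Lyapunov exponent $\sigma=\sigma(\mathcal{A})$ is the infimum of all $\beta\in\mathbb{R}$ such that every trajectory satisfies $\|x(t)\|\le C e^{\beta t}$ for all $t\ge 0$ with a constant $C$ depending on the trajectory. A nonempty compact set $K\subset\mathbb{R}^d$, $K\neq\{0\}$, is invariant for $\mathcal{A}$ if $K_t\subset e^{\sigma t}K$ for all $t\ge0$. The system is irreducible if the matrices of $\mathcal{A}$ do not share a common invariant nontrivial linear subspace (that is, one other than $\{0\}$ and $\mathbb{R}^d$). A boundary point $a$ of a convex body $G$ (a convex compact set with nonempty interior) is conical if there exist an outer normal vector $n\neq0$ at $a$ (that is, $\max_{x\in G}(n,x-a)=0$) and a constant $c>0$ such that $(n,x-a)\le -c\|x-a\|$ for all $x\in G$; equivalently, the tangent cone at $a$ (the closed cone generated by $\{x-a:\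 x\in G\}$) contains no straight line.
   Formalization: The claim that M contains the origin is stated with the case d = 1 and A a single matrix excluded, since there it fails: for A = {[a]}, a ≠ 0, the set M = {1} is convex and invariant but misses the origin. *)

(* Defs.v *)
From HB Require Import structures.
From mathcomp Require Import all_boot all_order all_algebra.
From mathcomp Require Import all_classical all_reals all_analysis.

Set Implicit Arguments.
Unset Strict Implicit.
Unset Printing Implicit Defensive.

Import Order.TTheory GRing.Theory Num.Theory.
Import numFieldNormedType.Exports.

Local Open Scope classical_set_scope.
Local Open Scope ring_scope.

Section Defs.
Variables (R : realType) (d : nat).

(* The topology of 'cV[R]_d comes from the library's max norm, which is
   equivalent to the Euclidean norm [enorm]. *)
Definition dotp (u v : 'cV[R]_d) : R := \sum_i u i 0 * v i 0.

Definition enorm (v : 'cV[R]_d) : R := Num.sqrt (dotp v v).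

Definition is_system (A : set 'M[R]_d) : Prop :=
  [/\ A !=set0, compact A, convex_set A & ~ A 0].

(* Functions on [0, +oo[ are total functions on R whose values at negative
   times are never used. *)
Definition switching_law (A : set 'M[R]_d) (u : R -> 'M[R]_d) : Prop :=
  (forall t : R, 0 <= t -> A (u t)) /\
  (forall i j, measurable_fun (`[0, +oo[ : set R) (fun t => u t i j)).

Definition abs_continuous (a b : R) (x : R -> 'cV[R]_d) : Prop :=
  forall e : R, 0 < e -> exists2 delta : R, 0 < delta &
    forall (n : nat) (l r : 'I_n -> R),
      (forall i, [/\ a <= l i, l i <= r i & r i <= b]) ->
      (forall i j, i != j -> r i <= l j \/ r j <= l i) ->
      \sum_i (r i - l i) < delta ->
      \sum_i enorm (x (r i) - x (l i)) < e.

(* On the unbounded interval [0, +oo[ absolute continuity is meant on every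
   compact subinterval. The derivative is two-sided, which differs from the
   derivative on [0, +oo[ only at the null set {0}. *)
Definition trajectory (A : set 'M[R]_d) (x : R -> 'cV[R]_d) : Prop :=
  (forall T : R, 0 <= T -> abs_continuous 0 T x) /\
  exists2 u, switching_law A u &
    {ae (@lebesgue_measure R), forall t : R, 0 <= t ->
      is_derive t 1 x (u t *m x t)}.

Definition reach (A : set 'M[R]_d) (K : set 'cV[R]_d) (t : R) :
    set 'cV[R]_d :=
  [set y | exists x, [/\ trajectory A x, K (x 0) & y = x t]].

(* [inf] is the real infimum (with value 0 on the empty set and on sets
   unbounded below); for a nonempty compact A and d >= 1 the set below is
   nonempty and bounded below. *)
Definition lyapunov_exponent (A : set 'M[R]_d) : R :=
  inf [set beta : R | forall x, trajectory A x ->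
    exists C : R, forall t : R, 0 <= t ->
      enorm (x t) <= C * expR (beta * t)].

Definition invariant_set (A : set 'M[R]_d) (K : set 'cV[R]_d) : Prop :=
  [/\ K !=set0, compact K, K <> [set 0] &
    forall t : R, 0 <= t ->
      reach A K t `<=` [set expR (lyapunov_exponent A * t) *: y | y in K]].

Definition irreducible (A : set 'M[R]_d) : Prop :=
  forall V : {vspace 'cV[R]_d},
    (forall B, A B -> forall v, v \in V -> B *m v \in V) ->
    V = 0%VS \/ V = fullv.

Definition convex_body (G : set 'cV[R]_d) : Prop :=
  [/\ convex_set G, compact G & interior G !=set0].

Definition boundary (G : set 'cV[R]_d) : set 'cV[R]_d :=
  closure G `\` interior G.

(* The maximum of (n, x - a) over G is attained, with value 0, at x = a. *)
Definition outer_normal (G : set 'cV[R]_d) (a n : 'cV[R]_d) : Prop :=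
  [/\ n != 0, G a & forall x, G x -> dotp n (x - a) <= 0].

Definition conical_point (G : set 'cV[R]_d) (a : 'cV[R]_d) : Prop :=
  [/\ convex_body G, boundary G a &
    exists (n : 'cV[R]_d) (c : R), [/\ outer_normal G a n, 0 < c &
      forall x, G x -> dotp n (x - a) <= - c * enorm (x - a)]].

End Defs.

(* Main.v *)
(** Each constant control [B] in [A] yields the trajectories [exp(tB) x], so an
    invariant set [K] is mapped into itself by [exp(-s t) exp(tB)], and a linear
    subspace preserved by all [exp(tB)] is preserved by [A], hence trivial or full.
    For convex [K] this applies to the cone [R_+ (K - K)], which is a subspace.

    Suppose that [K] misses [0], and let [r] be the largest ratio of two points of
    [K] on a common ray.  The set [K `&` r^-1 K] is again invariant and meets every
    ray at most once.  If its differences span the whole space, one of its points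
    is [x0 = a (u - v)], so [(x0 + a v) / (1 + a)] is a second point on the ray of
    [u]: a contradiction.  Otherwise it is a single point, whose line is invariant,
    so that [d = 1] and [A] is a singleton.

    Suppose now that [K] contains [0]; then [K - K] spans the space and [K] has
    interior points.  The orthogonal complement of the polar cone of [K] is an
    invariant subspace.  If it is the whole space the polar cone is trivial and [0]
    is interior; if it is [0], every [e_i] is a difference [n_i - m_i] of polar
    vectors, and [sum_i (n_i + m_i)] is a normal which makes [0] conical. *)
Require Import Defs.
From HB Require Import structures.
From mathcomp Require Import all_boot all_order all_algebra.
From mathcomp Require Import all_classical all_reals all_analysis.
From mathcomp Require Import ring lra.

Set Implicit Arguments.
Unset Strict Implicit.
Unset Printing Implicit Defensive.

Import Order.TTheory GRing.Theory Num.Theory.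
Import numFieldNormedType.Exports.

Local Open Scope classical_set_scope.
Local Open Scope ring_scope.

(** * The matrix exponential and its derivative *)

Section MatrixExponential.
Context {R : realType} {d : nat}.
Variable B : 'M[R]_d.

Definition mxpow (n : nat) : 'M[R]_d := iter n (mulmx B) 1%:M.

Definition mxexp_coeff i j (n : nat) : R := mxpow n i j / n`!%:R.

(** exp(tB), taken entry by entry so that term-by-term differentiation of scalar power series
    applies. *)
Definition mxexp (t : R) : 'M[R]_d :=
  \matrix_(i, j) limn (pseries (mxexp_coeff i j) t).

(** Each multiplication by [B] costs at most the absolute sum of one row, which is part of the total
    sum. *)
Lemma mxpow_bound n i j : `|mxpow n i j| <= (\sum_k \sum_l `|B k l|) ^+ n.
Proof.
have K0 : 0 <= \sum_k \sum_l `|B k l|.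
  by apply: sumr_ge0 => k _; apply: sumr_ge0.
elim: n i j => [|n IH] i j.
  by rewrite /mxpow /= mxE expr0; case: eqP => _; rewrite ?normr1 ?normr0.
rewrite /mxpow iterS mxE exprS (le_trans (ler_norm_sum _ _ _))//.
apply: (@le_trans _ _ (\sum_l `|B i l| * (\sum_k \sum_l `|B k l|) ^+ n)).
  by apply: ler_sum => l _; rewrite normrM ler_wpM2l.
rewrite -mulr_suml ler_wpM2r ?exprn_ge0//.
rewrite [leRHS](bigD1 i)//= lerDl; apply: sumr_ge0 => k _; exact: sumr_ge0.
Qed.

Lemma is_cvg_mxexp i j (t : R) : cvgn (pseries (mxexp_coeff i j) t).
Proof.
apply: normed_cvg.
pose K : R := \sum_k \sum_l `|B k l|.
apply: (@series_le_cvg _ _ (exp_coeff (K * `|t|))) => [n|n|n|] //=.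
- rewrite /exp_coeff divr_ge0// exprn_ge0// mulr_ge0//.
  by apply: sumr_ge0 => k _; apply: sumr_ge0.
- rewrite /exp_coeff /mxexp_coeff normrM normrX normrM normfV.
  rewrite (ger0_norm (ler0n _ _)) /K /= exprMn mulrAC ler_wpM2r ?invr_ge0//.
  by rewrite ler_wpM2r ?exprn_ge0// mxpow_bound.
- exact: is_cvg_series_exp_coeff.
Qed.

(** The coefficient form of exp(tB)' = B exp(tB). *)
Lemma pseries_diffs_mxexp i j :
  pseries_diffs (mxexp_coeff i j) = fun n => \sum_k B i k * mxexp_coeff k j n.
Proof.
apply/funext => n; rewrite /pseries_diffs /mxexp_coeff /mxpow iterS mxE.
rewrite mulr_suml mulr_sumr; apply: eq_bigr => k _.
by rewrite factS natrM invfM mulrCA !mulrA mulfK.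
Qed.

Lemma cvg_pseries_comb (a : 'I_d -> R) (c : 'I_d -> R^nat) (t : R) :
  (forall k, cvgn (pseries (c k) t)) ->
  pseries (fun n => \sum_k a k * c k n) t @ \oo -->
    \sum_k a k * limn (pseries (c k) t).
Proof.
move=> Hc.
have -> : pseries (fun n => \sum_k a k * c k n) t =
    fun n => \sum_k a k * pseries (c k) t n.
  apply/funext => n; rewrite /pseries /series /=.
  under [RHS]eq_bigr do rewrite mulr_sumr.
  rewrite exchange_big /=; apply: eq_bigr => m _.
  by rewrite mulr_suml; apply: eq_bigr => k _; rewrite mulrA.
apply: cvg_big => [|k _]; first exact: add_continuous.
apply: cvgM; [exact: cvg_cst|exact: Hc].
Qed.

Lemma is_derive_mxexp_entry i j (t : R) :
  is_derive t (1 : R) (fun s => mxexp s i j) ((B *m mxexp t) i j).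
Proof.
(* [pseries_snd_diffs] asks for convergence of the series and of its first two formal derivatives at
   a point beyond [t], here [|t| + 1]. *)
have cd (i' : 'I_d) x : cvgn (pseries (pseries_diffs (mxexp_coeff i' j)) x).
  rewrite pseries_diffs_mxexp; apply/cvg_ex; eexists.
  by apply: cvg_pseries_comb => k; exact: is_cvg_mxexp.
have cdd x : cvgn (pseries (pseries_diffs (pseries_diffs (mxexp_coeff i j))) x).
  have -> : pseries_diffs (pseries_diffs (mxexp_coeff i j)) =
      fun n => \sum_k B i k * pseries_diffs (mxexp_coeff k j) n.
    apply/funext => n; rewrite [in LHS]pseries_diffs_mxexp /pseries_diffs.
    by rewrite mulr_sumr; apply: eq_bigr => k _; rewrite mulrCA.
  apply/cvg_ex; eexists.
  by apply: cvg_pseries_comb => k; exact: cd.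
have -> : (B *m mxexp t) i j = limn (pseries (pseries_diffs (mxexp_coeff i j)) t).
  rewrite pseries_diffs_mxexp mxE; apply/esym/cvg_lim => //.
  under [X in _ --> X]eq_bigr do rewrite mxE.
  by apply: cvg_pseries_comb => k; exact: is_cvg_mxexp.
have -> : (fun s => mxexp s i j) = fun s => limn (pseries (mxexp_coeff i j) s).
  by apply/funext => s; rewrite mxE.
apply: (@pseries_snd_diffs _ _ (`|t| + 1)) => //; first exact: is_cvg_mxexp.
by rewrite [ltRHS]ger0_norm ?addr_ge0// ltrDl.
Qed.

Lemma mxexp0 : mxexp 0 = 1%:M.
Proof.
apply/matrixP => i j; rewrite [LHS]mxE; apply/cvg_lim => //.
(* The empty partial sum is dropped; every later one reduces to its term of index 0. *)
rewrite -cvg_shiftS /=.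
set u := (X in X @ _ --> _).
suff -> : u = cst (1%:M i j) by exact: cvg_cst.
apply/funext => n; rewrite /u /pseries /series /= big_nat_recl// expr0 mulr1.
rewrite big1 ?addr0 => [|k _]; first by rewrite /mxexp_coeff fact0 divr1.
by rewrite expr0n mulr0.
Qed.

End MatrixExponential.

(** * Convex combinations, and exponentials as trajectories *)

Lemma convex_comb {R : realType} {V : lmodType R} {K : set V} {a b : R} {u v : V} :
  convex_set K -> K u -> K v -> 0 <= a -> 0 <= b -> a + b = 1 ->
  K (a *: u + b *: v).
Proof.
move=> cK Ku Kv a0 b0 ab.
have a1 : a <= 1 by rewrite -ab lerDl.
have := cK u v (Itv01 a0 a1); rewrite !inE => /(_ Ku Kv).
by rewrite /conv /= /unstable.onem (_ : 1 - a = b)// -ab addrC addKr.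
Qed.

Lemma enorm_le_sum {R : realType} {d : nat} (x : 'cV[R]_d) :
  enorm x <= \sum_i `|x i 0|.
Proof.
have S0 : 0 <= \sum_i `|x i 0| by exact: sumr_ge0.
rewrite -[leRHS]ger0_norm// -sqrtr_sqr ler_sqrt ?sqr_ge0// expr2 mulr_suml.
apply: ler_sum => i _; rewrite (le_trans (ler_norm _))// normrM ler_wpM2l//.
by rewrite (bigD1 i)//= lerDl sumr_ge0.
Qed.

Lemma lipschitz_abs_continuous {R : realType} {d : nat} (a b L : R)
    (x : R -> 'cV[R]_d) :
  (forall l r, a <= l -> l <= r -> r <= b -> enorm (x r - x l) <= L * (r - l)) ->
  abs_continuous a b x.
Proof.
move=> xL e e0; have L0 : 0 < `|L| + 1 by rewrite ltr_wpDl.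
exists (e / (`|L| + 1)); first exact: divr_gt0.
move=> n l r lr _; rewrite ltr_pdivlMr// mulrC mulr_sumr; apply: le_lt_trans.
apply: ler_sum => i _; have [al lri rb] := lr i.
rewrite (le_trans (xL _ _ al lri rb))// ler_wpM2r ?subr_ge0//.
by rewrite (le_trans (ler_norm _))// lerDl.
Qed.

Lemma is_derive_mxexp {R : realType} {d : nat} (B : 'M[R]_d) (x : 'cV[R]_d) (t : R) :
  is_derive t 1 (fun s => mxexp B s *m x) (B *m (mxexp B t *m x)).
Proof.
have dij i : is_derive t (1 : R) (fun s => (mxexp B s *m x) i 0)
    ((B *m (mxexp B t *m x)) i 0).
  rewrite mulmxA mxE; under eq_fun do rewrite mxE.
  have -> : (fun s => \sum_j mxexp B s i j * x j 0) =
      \sum_j (fun s => mxexp B s i j * x j 0).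
    by apply/funext => s; rewrite fct_sumE.
  apply: is_derive_sum => j.
  rewrite mulrC; under eq_fun do rewrite mulrC.
  exact: (is_deriveZ (x j 0) (is_derive_mxexp_entry B i j t)).
have dx : derivable (fun s => mxexp B s *m x) t 1.
  apply/derivable_mxP => i j; rewrite ord1.
  exact: (@ex_derive _ _ _ _ _ _ _ (dij i)).
apply: DeriveDef => //; rewrite derive_mx//; apply/matrixP => i j.
by rewrite mxE ord1; exact: (@derive_val _ _ _ _ _ _ _ (dij i)).
Qed.

(** The switching law is constant. Each coordinate of the velocity is continuous, hence bounded on
    [[0, T]], and the mean value theorem makes the curve Lipschitz there. *)
Lemma mxexp_trajectory {R : realType} {d : nat} (A : set 'M[R]_d) (B : 'M[R]_d)
    (x : 'cV[R]_d) :
  A B -> trajectory A (fun t => mxexp B t *m x).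
Proof.
move=> AB; split; last first.
  exists (fun=> B); last by apply: aeW => t _; exact: is_derive_mxexp.
  by split => // i j; exact: measurable_cst.
move=> T T0.
pose y t := mxexp B t *m x.
have dy (v : 'cV[R]_d) i t : is_derive t (1 : R) (fun s => (mxexp B s *m v) i 0)
    ((B *m (mxexp B t *m v)) i 0).
  have dv := is_derive_mxexp B v t.
  apply: DeriveDef; first by have /derivable_mxP := @ex_derive _ _ _ _ _ _ _ dv; exact.
  have := @derive_val _ _ _ _ _ _ _ dv.
  by rewrite derive_mx// => /matrixP/(_ i 0); rewrite mxE.
have cy i : {within `[0, T], continuous (fun t => `|(B *m y t) i 0|)}.
  apply: continuous_subspaceT => t; apply: cvg_norm.
  under eq_fun do rewrite mxE; rewrite mxE.
  apply: cvg_big => [|k _]; first exact: add_continuous.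
  apply: cvgM; first exact: cvg_cst.
  by apply/differentiable_continuous/derivable1_diffP; exact: ex_derive.
have bd i : exists2 K, 0 <= K & forall t, t \in `[0, T] -> `|(B *m y t) i 0| <= K.
  have [c _ cmax] := EVT_max T0 (cy i).
  by exists `|(B *m y c) i 0|.
pose K i := s2val (cid2 (bd i)).
apply: (@lipschitz_abs_continuous _ _ _ _ (\sum_i K i)) => l r l0 lr rT.
apply: le_trans (enorm_le_sum _) _; rewrite mulr_suml; apply: ler_sum => i _.
have [|c clr] := @MVT_segment R (fun s => y s i 0) (fun s => (B *m y s) i 0) l r lr
  (fun t _ => dy x i t).
  by apply: derivable_within_continuous => t _; exact: ex_derive.
rewrite [in X in _ -> X]mxE [X in _ -> `|_ + X| <= _]mxE => ->.
rewrite normrM (ger0_norm (_ : 0 <= r - l)) ?subr_ge0//.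
rewrite ler_wpM2r ?subr_ge0// /K; case: cid2 => /= k _; apply.
move: clr; rewrite !in_itv /= => /andP[lc cr].
by rewrite (le_trans l0 lc) (le_trans cr rT).
Qed.

(** * Linear subspaces given as sets, and the dot product *)

Section LinearSet.
Context {R : realType} {d : nat}.
Implicit Types (P : set 'cV[R]_d) (n x y z : 'cV[R]_d).

Definition linear_set P := P 0 /\ forall a x y, P x -> P y -> P (a *: x + y).

(** A subspace of maximal dimension inside [P] exhausts [P]: a point of [P] outside it could be
    adjoined. *)
Lemma linear_set_vspace P : linear_set P ->
  exists U : {vspace 'cV[R]_d}, forall x, x \in U <-> P x.
Proof.
move=> [P0 Plin].
pose Q k := `[< exists2 U : {vspace 'cV[R]_d}, \dim U = k & forall x, x \in U -> P x >].
have Q0 : exists k, Q k.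
  exists 0%N; apply/asboolP; exists 0%VS; first exact: dimv0.
  by move=> x; rewrite memv0 => /eqP ->.
have Qb k : Q k -> (k <= \dim {: 'cV[R]_d})%N.
  by move=> /asboolP[U <- _]; exact/dimvS/subvf.
have [k /asboolP[U Uk UP] kmax] := ex_maxnP Q0 Qb.
exists U => x; split=> [|Px]; first exact: UP.
apply/negPn/negP => xU.
have /kmax : Q (\dim (U + <[x]>)).
  apply/asboolP; exists (U + <[x]>)%VS => // y /memv_addP[u uU [v /vlineP[a ->] ->]].
  by rewrite addrC; apply: Plin => //; exact: UP.
rewrite -Uk => kU; case/negP: xU.
have := geq_leqif (dimv_leqif_sup (addvSl U <[x]>)).
rewrite kU => /esym/subvP; apply.
by rewrite memvE addvSr.
Qed.

Lemma linear_setZ P a x : linear_set P -> P x -> P (a *: x).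
Proof. by move=> [P0 Pl] Px; rewrite -[_ *: _]addr0; exact: Pl. Qed.

Lemma linear_setB P x y : linear_set P -> P x -> P y -> P (x - y).
Proof. by move=> [_ Pl] Px Py; rewrite addrC -scaleN1r; exact: Pl. Qed.

Lemma dotpC x y : dotp x y = dotp y x.
Proof. by apply: eq_bigr => i _; rewrite mulrC. Qed.

Lemma dotpDr n x y : dotp n (x + y) = dotp n x + dotp n y.
Proof. by rewrite -big_split; apply: eq_bigr => i _; rewrite mxE mulrDr. Qed.

Lemma dotpZr n a x : dotp n (a *: x) = a * dotp n x.
Proof. by rewrite mulr_sumr; apply: eq_bigr => i _; rewrite mxE mulrCA. Qed.

Lemma dotpBr n x y : dotp n (x - y) = dotp n x - dotp n y.
Proof. by rewrite -scaleN1r dotpDr dotpZr mulN1r. Qed.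

Lemma dotpDl x y n : dotp (x + y) n = dotp x n + dotp y n.
Proof. by rewrite !(dotpC _ n) dotpDr. Qed.

Lemma dotpZl a x n : dotp (a *: x) n = a * dotp x n.
Proof. by rewrite !(dotpC _ n) dotpZr. Qed.

Lemma dotpBl x y n : dotp (x - y) n = dotp x n - dotp y n.
Proof. by rewrite !(dotpC _ n) dotpBr. Qed.

Lemma dotp_ge0 x : 0 <= dotp x x.
Proof. by apply: sumr_ge0 => i _; rewrite -expr2 sqr_ge0. Qed.

Lemma dotp_eq0 x : dotp x x = 0 -> x = 0.
Proof.
move/eqP; rewrite psumr_eq0 => [/allP x0|i _]; last by rewrite -expr2 sqr_ge0.
apply/colP => i; rewrite mxE; apply/eqP.
by have := x0 i; rewrite mem_index_enum -expr2 sqrf_eq0; apply.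
Qed.

Lemma dotp_subZ_sqr t x y :
  dotp (x - t *: y) (x - t *: y) =
    dotp x x - 2 * t * dotp x y + t ^+ 2 * dotp y y.
Proof. by rewrite !(dotpBl, dotpBr, dotpZl, dotpZr) (dotpC y x); ring. Qed.

Lemma dotp0r n : dotp n 0 = 0.
Proof. by rewrite -(scale0r 0) dotpZr mul0r. Qed.

Lemma dotp_trmx (B : 'M[R]_d) n x : dotp (B^T *m n) x = dotp n (B *m x).
Proof.
rewrite /dotp; under eq_bigr do rewrite mxE mulr_suml.
under [RHS]eq_bigr do rewrite mxE mulr_sumr.
rewrite exchange_big; apply: eq_bigr => i _; apply: eq_bigr => j _.
by rewrite mxE -mulrA mulrCA.
Qed.

Lemma continuous_dotp n : continuous (dotp n).
Proof.
apply: continuous_big => [|i _ x]; first exact: add_continuous.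
by apply: continuousM; [exact: cst_continuous | exact: coord_continuous].
Qed.

(** The map [y - projv U y] vanishes exactly on [P]; [n] represents one of its coordinates that is
    nonzero at [x]. *)
Lemma linear_set_annihilator P x : linear_set P -> ~ P x ->
  exists2 n, dotp n x != 0 & forall y, P y -> dotp n y = 0.
Proof.
move=> Pl nPx; have [U UP] := linear_set_vspace Pl.
pose f y := y - projv U y.
have : f x != 0.
  by apply: contra_notN nPx => /eqP/subr0_eq fx0; apply/UP; rewrite fx0 memv_proj.
move=> fx; have [i fxi] : exists i, f x i 0 != 0.
  apply: contrapT => f0; case/eqP: fx; apply/colP => i; rewrite [RHS]mxE.
  by apply/eqP/negPn/negP => fi; apply: f0; exists i.
pose n : 'cV[R]_d := \col_j f (delta_mx j 0) i 0.
have fn y : f y i 0 = dotp n y.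
  have -> : f y = \sum_j y j 0 *: f (delta_mx j 0).
    under eq_bigr do rewrite /f scalerBr -linearZ.
    rewrite sumrB -linear_sum /f [in LHS](matrix_sum_delta y).
    by congr (_ - projv U _); apply: eq_bigr => j _; rewrite big_ord1.
  by rewrite summxE; apply: eq_bigr => j _; rewrite !mxE mulrC.
exists n; first by rewrite -fn.
by move=> y /UP yU; rewrite -fn /f projv_id// subrr mxE.
Qed.

(** A vector annihilating [P] annihilates the difference quotients at 0, hence their limit. Only
    quotients from the right are used, since [z] is known to lie in [P] at nonnegative times
    only. *)
Lemma linear_set_derivative P (z : R -> 'cV[R]_d) (z' : 'cV[R]_d) :
  linear_set P -> is_derive (0 : R) 1 z z' -> (forall t, 0 <= t -> P (z t)) -> P z'.
Proof.
move=> Pl dz Pz; apply: contrapT => nPz'.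
have [n /eqP nz' nP] := linear_set_annihilator Pl nPz'; apply: nz'.
have : h^-1 *: ((z \o shift 0) (h *: (1 : R)) - z 0) @[h --> 0^'] --> z'.
  by rewrite -(@derive_val _ _ _ _ _ _ _ dz); exact: (@ex_derive _ _ _ _ _ _ _ dz).
move=> /cvg_dnbhs_at_right /(continuous_cvg _ (@continuous_dotp n z')) cz.
apply: (cvg_unique _ cz); first exact: norm_hausdorff.
apply: cvg_near_cst; near=> h.
have h0 : 0 <= h by near: h; exact: nbhs_right_ge.
apply: nP; apply: linear_setZ => //; apply: linear_setB => //; apply: Pz => //=.
by rewrite addr0 [_ *: _]mulr1.
Unshelve. all: by end_near. Qed.

Lemma irreducible_linear_set (A : set 'M[R]_d) P :
  irreducible A -> linear_set P -> (forall B, A B -> forall x, P x -> P (B *m x)) ->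
  (forall x, P x -> x = 0) \/ (forall x, P x).
Proof.
move=> irrA /linear_set_vspace[U UP] AP.
have [B AB x /UP Px|U0|UT] := irrA U; first by apply/UP; exact: AP.
- by left => x /UP; rewrite U0 memv0 => /eqP.
- by right => x; apply/UP; rewrite UT memvf.
Qed.

End LinearSet.

(** * Flow-invariant sets and the subspace of their directions *)

Section ConvexInvariant.
Context {R : realType} {d : nat}.
Implicit Types (A : set 'M[R]_d) (K : set 'cV[R]_d) (x y z u v : 'cV[R]_d).

Definition flow_invariant A (s : R) K := forall B t x,
  A B -> 0 <= t -> K x -> K (expR (- (s * t)) *: (mxexp B t *m x)).

Lemma invariant_set_flow A K :
  invariant_set A K -> flow_invariant A (lyapunov_exponent A) K.
Proof.
move=> [_ _ _ AK] B t x AB t0 Kx.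
have [|y Ky <-] := AK t t0 (mxexp B t *m x).
  exists (fun s => mxexp B s *m x); split => //; first exact: mxexp_trajectory.
  by rewrite mxexp0 mul1mx.
by rewrite scalerA -expRD addNr expR0 scale1r.
Qed.

(** [B *m x] is the derivative at 0 of a curve that stays in [P]. *)
Lemma invariant_linear_set A P : linear_set P ->
  (forall B t x, A B -> 0 <= t -> P x -> P (mxexp B t *m x)) ->
  forall B, A B -> forall x, P x -> P (B *m x).
Proof.
move=> Pl AP B AB x Px.
have := is_derive_mxexp B x 0; rewrite mxexp0 mul1mx => dx.
by apply: (linear_set_derivative Pl dx) => t t0; exact: AP.
Qed.

Definition directions K : set 'cV[R]_d :=
  [set z | exists a u v, [/\ 0 <= a, K u, K v & z = a *: (u - v)]].

(** The sum of [a (u - v)] and [b (u' - v')] is [a + b] times a difference of two averages with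
    weights [a / (a + b)] and [b / (a + b)]; a negative factor exchanges [u] and [v]. *)
Lemma linear_directions K : convex_set K -> K !=set0 -> linear_set (directions K).
Proof.
move=> cK [x0 Kx0].
have D0 : directions K 0 by exists 0, x0, x0; rewrite scale0r.
have DD x y : directions K x -> directions K y -> directions K (x + y).
  move=> [a [u [v [a0 Ku Kv ->]]]] [b [u' [v' [b0 Ku' Kv' ->]]]].
  have [ab0|ab0] := eqVneq (a + b) 0.
    have := ab0 => /eqP; rewrite paddr_eq0// => /andP[/eqP -> /eqP ->].
    by rewrite !scale0r addr0.
  exists (a + b), (a / (a + b) *: u + b / (a + b) *: u'),
    (a / (a + b) *: v + b / (a + b) *: v').
  have ab : a / (a + b) + b / (a + b) = 1 by rewrite -mulrDl divff.
  split; first exact: addr_ge0.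
  - by apply: convex_comb; rewrite ?divr_ge0 ?addr_ge0.
  - by apply: convex_comb; rewrite ?divr_ge0 ?addr_ge0.
  rewrite !scalerBr !scalerDr !scalerA ![(a + b) * _]mulrC !divfK//.
  by rewrite opprD addrACA.
split => // a x y [b [u [v [b0 Ku Kv ->]]]] Dy; apply: DD => //.
have [a0|a0] := leP 0 a.
  by exists (a * b), u, v; rewrite mulr_ge0// scalerA.
exists (- a * b), v, u; split => //; first by rewrite mulr_ge0// oppr_ge0 ltW.
by rewrite -(opprB u v) scalerN mulNr scaleNr opprK scalerA.
Qed.

Lemma irreducible_directions A s K :
  irreducible A -> flow_invariant A s K -> convex_set K -> K !=set0 ->
  (forall u v, K u -> K v -> u = v) \/ (forall z, directions K z).
Proof.
move=> irrA AK cK K0; have Dl := linear_directions cK K0.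
have [|D0|DT] := irreducible_linear_set irrA Dl; last by right.
- apply: invariant_linear_set => // B t _ AB t0 [a [u [v [a0 Ku Kv ->]]]].
  (* The nonnegative scalar absorbs the normalisation that brings both end points back into [K]. *)
  exists (a * expR (s * t)), (expR (- (s * t)) *: (mxexp B t *m u)),
    (expR (- (s * t)) *: (mxexp B t *m v)).
  split; rewrite ?mulr_ge0 ?expR_ge0//; [exact: AK|exact: AK|].
  rewrite -scalerBr -mulmxBr -scalemxAr scalerA -mulrA -expRD.
  by rewrite addrN expR0 mulr1.
- left => u v Ku Kv; apply/subr0_eq/D0; exists 1, u, v.
  by rewrite scale1r ler01.
Qed.

(** * The origin belongs to the invariant set *)

Lemma directions_full_ray K : convex_set K -> ~ K 0 -> K !=set0 ->
  (forall z, directions K z) ->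
  exists c u, [/\ 0 < c, c < 1, K u & K (c *: u)].
Proof.
move=> cK nK0 [x0 Kx0] /(_ x0)[a [u [v [a0 Ku Kv x0E]]]].
have a_gt0 : 0 < a.
  rewrite lt_neqAle a0 andbT; apply: contra_not_neq nK0 => a00.
  by rewrite -(scale0r (u - v)) a00 -x0E.
have a1 : 0 < 1 + a by rewrite addr_gt0.
exists (a / (1 + a)), u; split => //.
- by rewrite divr_gt0.
- by rewrite ltr_pdivrMr// mul1r ltrDr.
- have -> : a / (1 + a) *: u = (1 + a)^-1 *: x0 + a / (1 + a) *: v.
    by rewrite x0E scalerA mulrC -scalerDr subrK.
  apply: convex_comb; rewrite ?divr_ge0 ?invr_ge0 ?ltW//.
  by rewrite -[X in X + _]mul1r -mulrDl divff// gt_eqF.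
Qed.

(** Norms on [K] lie between some [e > 0] and [C], so ratios are bounded by [C / e] and the
    admissible pairs [(r, x)] form a compact set, on which the first projection attains its maximum.
    Ratio 1 always occurs, whence [0 < r]. *)
Lemma max_ray_ratio K : compact K -> ~ K 0 -> K !=set0 ->
  exists r x, [/\ 0 < r, K x, K (r *: x) &
    forall r' x', K x' -> K (r' *: x') -> r' <= r].
Proof.
move=> cK nK0 [x0 Kx0].
have clK : closed K by apply: compact_closed => //; exact: norm_hausdorff.
have [C C0 KC] : exists2 C, 0 < C & forall x, K x -> `|x| <= C.
  have /ex_strict_bound_gt0[C C0 KC] := compact_bounded cK.
  by exists C => // x Kx; apply/ltW/KC.
have [e e0 Ke] : exists2 e, 0 < e & forall x, K x -> e <= `|x|.
  have : nbhs (0 : 'cV[R]_d) (~` K) by apply: open_nbhs_nbhs; split; rewrite ?openC.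
  move=> /nbhs_ballP[e e0 eK]; exists e => // x Kx.
  rewrite leNgt; apply/negP => xe; apply: (eK x) => //.
  by rewrite -ball_normE /= sub0r normrN.
have rb r x : K x -> K (r *: x) -> `|r| <= C / e.
  move=> Kx Krx; rewrite ler_pdivlMr//; apply: le_trans (KC _ Krx).
  by rewrite normrZ ler_wpM2l// Ke.
pose G : set (R * 'cV[R]_d) :=
  (`[- (C / e), C / e] `*` K) `&` [set p | K (p.1 *: p.2)].
have Gin r x : K x -> K (r *: x) -> G (r, x).
  by move=> Kx Krx; split => //=; split => //=; rewrite in_itv /= -ler_norml (rb _ x).
have cbox : compact (`[- (C / e), C / e] `*` K).
  by apply: compact_setX => //; exact: segment_compact.
have cG : compact G.
  apply: (subclosed_compact _ cbox) => [|p []//].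
  apply: closedI; first by apply: compact_closed => //; exact: norm_hausdorff.
  apply: (@preimage_closed _ _ (fun p : R * 'cV[R]_d => p.1 *: p.2)) => // p _.
  exact: scale_continuous.
have G0 : G !=set0 by exists (1, x0); apply: Gin => //; rewrite scale1r.
have [|[r x] + rmax] := @compact_EVT_max _ _ (fst : R * 'cV[R]_d -> R) G G0 cG.
  by apply: continuous_subspaceT => p; exact: cvg_fst.
rewrite inE => -[[/= _ Kx] Krx].
have rm r' x' : K x' -> K (r' *: x') -> r' <= r.
  by move=> Kx' Kr'; apply: (rmax (r', x')); rewrite inE; exact: Gin.
exists r, x; split => //; by rewrite (lt_le_trans ltr01)// (rm _ x0)// scale1r.
Qed.

(** Both exponentials send [v] to [expR (s * t) *: v], so the difference of the two curves stays in
    the zero subspace and so does its derivative at 0. *)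
Lemma flow_invariant_singleton A s v B B' : flow_invariant A s [set v] ->
  A B -> A B' -> B *m v = B' *m v.
Proof.
move=> Av AB AB'; apply/subr0_eq.
have l0 : linear_set [set (0 : 'cV[R]_d)].
  by split => // a x y -> ->; rewrite scaler0 addr0.
have := is_derive_mxexp B v 0; rewrite mxexp0 mul1mx => dB.
have := is_derive_mxexp B' v 0; rewrite mxexp0 mul1mx => dB'.
apply: (linear_set_derivative l0 (is_deriveB dB dB')) => t t0 /=.
have := etrans (Av B t v AB t0 erefl) (esym (Av B' t v AB' t0 erefl)).
by move=> /(scalerI (lt0r_neq0 (expR_gt0 _))) e; rewrite !fctE e subrr.
Qed.

Lemma span1_dim v : (forall z, exists a, z = a *: v) -> v != 0 -> d = 1%N.
Proof.
move=> vT v0; have [i vi] : exists i, v i 0 != 0.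
  apply: contrapT => f0; case/eqP: v0; apply/colP => i; rewrite [RHS]mxE.
  by apply/eqP/negPn/negP => fi; apply: f0; exists i.
apply/eqP; rewrite -[d]card_ord; apply/fintype1P; exists i => j.
apply/eqP/negPn/negP => ji; have [a /colP jav] := vT (delta_mx j 0).
have := jav i; rewrite !mxE eqxx andbT eq_sym (negbTE ji) => /esym/eqP.
rewrite mulf_eq0 (negbTE vi) orbF => /eqP a0.
by have := jav j; rewrite !mxE !eqxx a0 mul0r => /eqP; rewrite oner_eq0.
Qed.

Lemma invariant_contains_origin A s K :
  A !=set0 -> irreducible A -> compact K -> convex_set K -> K !=set0 ->
  flow_invariant A s K ->
  (d = 1%N -> ~ exists B, A = [set B]) -> K 0.
Proof.
move=> [B0 AB0] irrA cptK cK Kn AK dA; apply: contrapT => nK0.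
have [r [x0 [r0 Kx0 Krx0 rmax]]] := max_ray_ratio cptK nK0 Kn.
pose K1 : set 'cV[R]_d := K `&` [set x | K (r *: x)].
have K1n : K1 !=set0 by exists x0.
have nK10 : ~ K1 0 by case.
have cK1 : convex_set K1.
  move=> x y l; rewrite !inE => -[Kx Krx] [Ky Kry]; split.
    by have := cK x y l; rewrite !inE; apply.
  have := cK _ _ l (mem_set Krx) (mem_set Kry).
  by rewrite inE /conv /= scalerDr !scalerA !(mulrC r) -!scalerA.
have AK1 : flow_invariant A s K1.
  move=> B t x AB t0 [Kx Krx]; split; first exact: AK.
  by have := AK B t _ AB t0 Krx; rewrite /= -scalemxAr !scalerA mulrC.
have [K1v|K1T] := irreducible_directions irrA AK1 cK1 K1n; last first.
  (* Both [c *: u] and [r *: u] lie in [K], and their ratio [r / c] exceeds the maximal ratio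
     [r]. *)
  have [c [u [c0 c1 [Ku Kru] [Kcu Krcu]]]] := directions_full_ray cK1 nK10 K1n K1T.
  have := rmax (r / c) _ Kcu; rewrite scalerA divfK ?gt_eqF// => /(_ Kru).
  by rewrite leNgt ltr_pdivlMr// gtr_pMr// c1.
have K1E : K1 = [set x0].
  by apply/seteqP; split => [x K1x|x ->//]; exact: K1v.
rewrite K1E in AK1.
have x00 : x0 != 0 by apply: contra_not_neq nK0 => <-.
have L : linear_set [set z | exists a, z = a *: x0].
  split; first by exists 0; rewrite scale0r.
  by move=> a x y [b ->] [c ->]; exists (a * b + c); rewrite scalerDl scalerA.
have [||x0T] := irreducible_linear_set irrA L.
- apply: invariant_linear_set => [|B t _ AB t0 [a ->]]; first exact: L.
  exists (a * expR (s * t)); rewrite -{2}(AK1 B t x0 AB t0 erefl) /=.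
  by rewrite -scalemxAr scalerA -mulrA -expRD addrN expR0 mulr1.
- by move=> x0T; case/eqP: x00; apply: x0T; exists 1; rewrite scale1r.
apply: (dA (span1_dim x0T x00)); exists B0; apply/seteqP; split => [B AB|B ->//].
(* Each basis vector is a multiple of [x0], on which [B] and [B0] agree, so their columns
   coincide. *)
apply/matrixP => i j.
have [a aj] := x0T (delta_mx j 0).
have /(congr1 (fun w : 'cV[R]_d => w i 0)) :
    B *m delta_mx j (0 : 'I_1) = B0 *m delta_mx j 0.
  by rewrite aj -!scalemxAr (flow_invariant_singleton AK1 AB AB0).
by rewrite -!colE !mxE.
Qed.

(** * Interior points, separation and supporting hyperplanes *)

Lemma convex_average K n (f : 'I_n -> 'cV[R]_d) : (0 < n)%N ->
  convex_set K -> (forall i, K (f i)) -> K (n%:R^-1 *: \sum_i f i).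
Proof.
case: n f => // n f _ cK; elim: n f => [|n IH] f Kf.
  by rewrite big_ord1 invr1 scale1r.
have n1 : n.+1%:R != 0 :> R by rewrite pnatr_eq0.
have n2 : n.+2%:R != 0 :> R by rewrite pnatr_eq0.
rewrite big_ord_recr /= scalerDr.
have e : n.+2%:R^-1 = (n.+1%:R / n.+2%:R) * n.+1%:R^-1 :> R.
  by rewrite mulrAC divff// mul1r.
rewrite [X in X *: _ + _]e -scalerA; apply: convex_comb => //; first exact: IH.
by rewrite -[X in _ + X]mul1r -mulrDl natr1 divff.
Qed.

Lemma coord_le_norm x i : `|x i 0| <= `|x|.
Proof. by rewrite [leRHS]/Num.norm /= mx_normrE; exact: (le_bigmax _ _ (i, 0)). Qed.

(** [K] contains a segment in each coordinate direction, centred at the midpoint [g i]. The average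
    of these midpoints is interior: a small displacement is split into coordinates, one per
    segment. *)
Lemma directions_full_interior K : convex_set K -> (0 < d)%N ->
  (forall z, directions K z) -> interior K !=set0.
Proof.
move=> cK d0 KT; pose e (i : 'I_d) : 'cV[R]_d := delta_mx i 0.
have /choice[a] : forall i, exists a, exists u v,
    [/\ 0 <= a, K u, K v & e i = a *: (u - v)].
  by move=> i; exact: KT.
move=> /choice[u] /choice[v] auv.
have a0 i : 0 <= a i by have [] := auv i.
(* Then [|t| <= D^-1] gives [|t * a i| <= 1 / 2], which keeps the weights of [u i] and [v i]
   nonnegative. *)
pose D : R := 2 * (\sum_i a i + 1).
have D0 : 0 < D by rewrite mulr_gt0// ltr_wpDl// sumr_ge0.
pose g i : 'cV[R]_d := 2^-1 *: (u i + v i).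
have Kg i t : `|t| <= D^-1 -> K (g i + t *: e i).
  move=> tD; have [_ Ku Kv ->] := auv i.
  have /andP[ta1 ta2] : - 2^-1 <= t * a i <= 2^-1.
    rewrite -ler_norml normrM (ger0_norm (a0 i)).
    apply: (@le_trans _ _ (D^-1 * (\sum_i a i + 1))).
      apply: ler_pM => //; rewrite (bigD1 i)//= -addrA lerDl addr_ge0//.
      by rewrite sumr_ge0.
    rewrite /D invfM -mulrA mulVf ?mulr1//.
    by rewrite gt_eqF// ltr_wpDl// sumr_ge0.
  have -> : g i + t *: (a i *: (u i - v i)) =
      (2^-1 + t * a i) *: u i + (2^-1 - t * a i) *: v i.
    by rewrite /g scalerA scalerBr scalerDr scalerDl scalerBl addrACA.
  apply: convex_comb => //; lra.
pose c : 'cV[R]_d := d%:R^-1 *: \sum_i g i.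
have dR : (0 : R) < d%:R by rewrite ltr0n.
exists c; apply/nbhs_ballP; exists (D^-1 / d%:R) => /=.
  by rewrite divr_gt0// invr_gt0.
move=> y; rewrite -ball_normE /= => cy.
(* Averaging divides by [d], so each coordinate is amplified by [d]; hence the radius [D^-1 / d]. *)
have -> : y = d%:R^-1 *: \sum_i (g i + (d%:R * (y - c) i 0) *: e i).
  rewrite big_split /= scalerDr -/c scaler_sumr.
  under eq_bigr do rewrite scalerA mulrA mulVf ?gt_eqF// mul1r.
  rewrite -[LHS](subrKC c); congr (_ + _).
  by rewrite {1}(matrix_sum_delta (y - c)); apply: eq_bigr => i _; rewrite big_ord1.
apply: convex_average => // i; apply: Kg.
rewrite normrM gtr0_norm// mulrC -ler_pdivlMr//.
by rewrite (le_trans (coord_le_norm _ _))// -normrN opprB ltW.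
Qed.

(** The sphere is closed in the image of the compact box of row vectors under transposition, written
    as the visibly continuous sum [f]. *)
Lemma sphere_compact : compact [set n : 'cV[R]_d | `|n| = 1].
Proof.
pose f (r : 'rV[R]_d) : 'cV[R]_d := \sum_j r 0 j *: delta_mx j 0.
have fc : continuous f.
  apply: continuous_big => [|j _ x]; first exact: add_continuous.
  by apply: continuousZr_tmp; exact: coord_continuous.
have cbox := @rV_compact R d (fun=> `[-1, 1]%classic) (fun=> @segment_compact R (-1) 1).
apply: (subclosed_compact _ (continuous_compact (continuous_subspaceT fc) cbox)).
  apply: (@preimage_closed _ _ (fun n : 'cV[R]_d => `|n|) [set 1]) => [n _|].
    exact: norm_continuous.
  exact: closed_eq.
move=> n /= n1; exists n^T; last first.
  rewrite /f [RHS]matrix_sum_delta; apply: eq_bigr => j _.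
  by rewrite big_ord1 mxE.
by move=> i; rewrite mxE /= in_itv /= -ler_norml -n1 coord_le_norm.
Qed.

(** The normal is [z - p] for the point [p] of [K] nearest to [z]: at an acute angle with [x - p],
    moving from [p] towards [x] would come closer to [z]. *)
Lemma separation K z : compact K -> convex_set K -> K !=set0 -> ~ K z ->
  exists2 n, n != 0 & forall x, K x -> dotp n x <= dotp n z.
Proof.
move=> cptK cK Kn nKz.
have cd : {within K, continuous (fun x => dotp (z - x) (z - x))}.
  apply: continuous_subspaceT; apply: continuous_big => [|i _ x].
    exact: add_continuous.
  have cz : {for x, continuous (fun x => (z - x) i 0)}.
    rewrite (_ : (fun _ => _) = fun x => z i 0 - x i 0).
      by apply: continuousB; [exact: cst_continuous|exact: coord_continuous].
    by apply/funext => y; rewrite !mxE.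
  exact: continuousM.
have [p + pmin] := compact_EVT_min Kn cptK cd; rewrite inE => Kp.
exists (z - p) => [|x Kx].
  by rewrite subr_eq0; apply: contra_not_neq nKz => ->.
have np : dotp (z - p) (x - p) <= 0.
  rewrite leNgt; apply/negP => w0; set w := dotp _ _ in w0.
  set q := dotp (x - p) (x - p); have qw : 0 < w + q by rewrite ltr_wpDr// dotp_ge0.
  (* This step lies in []0, 1]] and satisfies [t * q < w], so the squared distance drops by
     [2 * t * w - t ^+ 2 * q > 0]. *)
  pose t := w / (w + q).
  have t0 : 0 < t by rewrite divr_gt0.
  have t1 : t <= 1 by rewrite ler_pdivrMr// mul1r lerDl dotp_ge0.
  have Ky : K ((1 - t) *: p + t *: x) by apply: convex_comb => //; lra.
  have := pmin _ (mem_set Ky).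
  have -> : z - ((1 - t) *: p + t *: x) = (z - p) - t *: (x - p).
    by apply/colP => i; rewrite !mxE; ring.
  rewrite leNgt => /negP; apply.
  rewrite dotp_subZ_sqr -/w -/q.
  have tE : t * (w + q) = w by rewrite divfK// gt_eqF.
  have : 0 < t * (w + t * w) by rewrite mulr_gt0// addr_gt0// mulr_gt0.
  have -> : t ^+ 2 * q = t * (w - t * w).
    by rewrite -[X in X - t * w]tE; ring.
  lra.
have := dotp_ge0 (z - p); move: np; rewrite !dotpBr; lra.
Qed.

(** Points outside [K] tending to 0 are separated from [K] by unit normals; a cluster point of these
    normals supports [K] at 0. *)
Lemma supporting_hyperplane K : compact K -> convex_set K -> K !=set0 ->
  ~ interior K 0 -> exists2 n, n != 0 & forall x, K x -> dotp n x <= 0.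
Proof.
move=> cptK cK Kn nK0.
have dotp_le n z : `|n| = 1 -> dotp n z <= d%:R * `|z|.
  move=> n1; rewrite mulr_natl -[d in _ *+ d]card_ord -sumr_const.
  apply: ler_sum => i _; rewrite (le_trans (ler_norm _))// normrM -[leRHS]mul1r.
  by apply: ler_pM => //; rewrite -?n1 coord_le_norm.
have approx e : 0 < e -> exists2 n, `|n| = 1 & forall x, K x -> dotp n x <= e.
  move=> e0; have [z ze nKz] : exists2 z, `|z| < e / d.+1%:R & ~ K z.
    apply: contrapT => H; apply: nK0; apply/nbhs_ballP.
    exists (e / d.+1%:R) => [|y]; first exact: divr_gt0.
    rewrite -ball_normE /= sub0r normrN => ye.
    by apply: contrapT => nKy; apply: H; exists y.
  have [n n0 Kn'] := separation cptK cK Kn nKz.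
  exists (`|n|^-1 *: n) => [|x Kx].
    by rewrite normrZ normfV normr_id mulVf// normr_eq0.
  apply: (@le_trans _ _ (dotp (`|n|^-1 *: n) z)).
    by rewrite !dotpZl ler_wpM2l// ?invr_ge0// Kn'.
  apply: le_trans (dotp_le _ _ _) _.
    by rewrite normrZ normfV normr_id mulVf// normr_eq0.
  move: ze; rewrite ltr_pdivlMr// mulrC => /ltW; apply: le_trans.
  by rewrite ler_wpM2r// ler_nat.
have /choice[n_ n_P] k : exists n, `|n| = 1 /\ forall x, K x -> dotp n x <= k.+1%:R^-1.
  by have [|n n1 Kn'] := approx k.+1%:R^-1; [rewrite invr_gt0|exists n].
have [|n [/= n1 n_n]] := @sphere_compact (n_ @ \oo) _.
  by exists 0%N => // k _; have [] := n_P k.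
exists n => [|x Kx]; first by rewrite -normr_eq0 n1 oner_neq0.
rewrite leNgt; apply/negP => nx0.
have nx2 : 0 < dotp n x / 2 by rewrite divr_gt0.
(* The first set contains [n_ k] for all large [k], the second is a neighbourhood of [n]; they would
   have to meet, but are disjoint. *)
have [] := n_n [set m | dotp m x <= dotp n x / 2] [set m | dotp n x / 2 < dotp m x].
- have := near_infty_natSinv_lt (PosNum nx2); apply: filterS => k /ltW ke /=.
  by apply: le_trans ke; have [_] := n_P k; exact.
- under eq_set => m do rewrite (dotpC m).
  have : dotp x m @[m --> n] --> dotp x n by exact: continuous_dotp.
  by move=> /cvgr_gt; apply; rewrite (dotpC x); lra.
- by move=> m [/= m1]; rewrite ltNge m1.
Qed.

(** * The origin is an interior or a conical point *)

Lemma spanning_polar_conical K : convex_body K -> K <> [set 0] -> K 0 ->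
  ~ interior K 0 ->
  (forall z, exists n m, [/\ forall x, K x -> dotp n x <= 0,
     forall x, K x -> dotp m x <= 0 & z = n - m]) ->
  conical_point K 0.
Proof.
move=> bK K_neq0 K0 nK0 span.
have /choice[n /choice[m nm]] : forall i : 'I_d, exists n m,
  [/\ forall x, K x -> dotp n x <= 0,
     forall x, K x -> dotp m x <= 0 & delta_mx i 0 = n - m].
  by move=> i; exact: span.
pose N := \sum_i (n i + m i).
have NK x : K x -> dotp N x <= - enorm x.
  move=> Kx; rewrite lerNr; apply: le_trans (enorm_le_sum x) _.
  have -> : - dotp N x = \sum_i - dotp (n i + m i) x.
    rewrite /N sumrN; congr (- _).
    by elim/big_ind2 : _ => [|a b c e <- <-|//]; rewrite ?dotpDl// dotpC dotp0r.
  apply: ler_sum => i _; have [nK mK nmi] := nm i.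
  have -> : x i 0 = dotp (n i) x - dotp (m i) x.
    rewrite -dotpBl -nmi /dotp (bigD1 i)//= big1 => [|j ji].
      by rewrite mxE !eqxx mul1r addr0.
    by rewrite mxE (negbTE ji) mul0r.
  (* Two nonpositive numbers differ in absolute value by at most minus their sum. *)
  by rewrite dotpDl ler_norml; have := nK x Kx; have := mK x Kx; lra.
split=> //; first by split => //; exact: subset_closure.
exists N, 1; split=> // [|x Kx]; last by rewrite !subr0 mulN1r NK.
split=> // [|x Kx]; last first.
  by rewrite subr0 (le_trans (NK x Kx))// oppr_le0 sqrtr_ge0.
(* If [N] were 0, the bound [NK] would force every point of [K] to have norm 0. *)
apply: contra_not_neq K_neq0 => N0; apply/seteqP; split=> [x Kx|x ->//].
apply/dotp_eq0/eqP; rewrite eq_le dotp_ge0 andbT -sqrtr_eq0 eq_le sqrtr_ge0 andbT.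
by have := NK x Kx; rewrite N0 dotpC dotp0r oppr_ge0.
Qed.

Lemma invariant_origin_dichotomy A s K :
  irreducible A -> compact K -> convex_set K -> K <> [set 0] -> K 0 ->
  flow_invariant A s K -> interior K 0 \/ conical_point K 0.
Proof.
move=> irrA cptK cK K_neq0 K0 AK.
have Kn : K !=set0 by exists 0.
have KT : forall z, directions K z.
  have [K1|//] := irreducible_directions irrA AK cK Kn.
  by case: K_neq0; apply/seteqP; split => [x Kx|x ->//]; exact: K1.
have d0 : (0 < d)%N.
  rewrite lt0n; apply: contra_not_neq K_neq0 => d0; apply/seteqP; split => [x _|x ->//].
  by apply/colP => i; move: (ltn_ord i); rewrite [X in (_ < X)%N]d0.
have iK := directions_full_interior cK d0 KT.
have [|nK0] := pselect (interior K 0); [by left|right].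
pose N : set 'cV[R]_d := [set n | forall x, K x -> dotp n x <= 0].
have [n0 n00 Nn0] : exists2 n, n != 0 & N n by exact: supporting_hyperplane.
have ND n m : N n -> N m -> N (n + m).
  by move=> Nn Nm x Kx; rewrite dotpDl; have := Nn x Kx; have := Nm x Kx; lra.
have NZ a n : 0 <= a -> N n -> N (a *: n).
  by move=> a0 Nn x Kx; rewrite dotpZl mulr_ge0_le0// Nn.
pose W : set 'cV[R]_d := [set z | forall n, N n -> dotp n z = 0].
have lW : linear_set W.
  split=> [n _|a x y Wx Wy n Nn]; first by rewrite dotp0r.
  by rewrite dotpDr dotpZr Wx// Wy// mulr0 addr0.
have [||WT] := irreducible_linear_set irrA lW; last first.
- by case/eqP: n00; apply: dotp_eq0; exact: WT.
- move=> W0; apply: spanning_polar_conical => // z.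
  apply: contrapT => nz.
  (* [N] is a convex cone, so [D] is a subspace. A vector orthogonal to [D] is orthogonal to [N],
     hence lies in [W] and vanishes, so [D] is the whole space. *)
  pose D : set 'cV[R]_d := [set z | exists n m, [/\ N n, N m & z = n - m]].
  have N0 : N 0 by move=> x _; rewrite dotpC dotp0r.
  have lD : linear_set D.
    split; first by exists 0, 0; rewrite subrr.
    move=> a _ _ [n [m [Nn Nm ->]]] [n' [m' [Nn' Nm' ->]]].
    have [a0|a0] := leP 0 a.
      exists (a *: n + n'), (a *: m + m'); split; [by auto|by auto|].
      by rewrite scalerBr opprD addrACA.
    exists (- a *: m + n'), (- a *: n + m').
    have na0 : 0 <= - a by rewrite oppr_ge0 ltW.
    split; [by auto|by auto|].
    by apply/colP => i; rewrite !mxE; ring.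
  have [y yz yD] := linear_set_annihilator lD nz.
  have y0 : y = 0.
    by apply: W0 => n Nn; rewrite dotpC; apply: yD; exists n, 0; rewrite subr0.
  by move: yz; rewrite y0 dotpC dotp0r eqxx.
(* The transpose of exp(tB) maps the polar cone [N] into itself because exp(tB) maps [K] into a
   positive multiple of [K]; by duality exp(tB) preserves [W]. *)
- apply: invariant_linear_set => // B t z AB t0 Wz n Nn.
  rewrite -dotp_trmx; apply: Wz => x Kx; rewrite dotp_trmx.
  have := Nn _ (AK B t x AB t0 Kx).
  by rewrite dotpZr pmulr_rle0// expR_gt0.
Qed.

End ConvexInvariant.

(** The premise on [d = 1] excludes a genuine exception: for a single nonzero number, all
    trajectories are multiples of one exponential, and every nonempty compact set other than the
    origin alone is invariant. *)
Theorem theorem6 (R : realType) (d : nat) (A : set 'M[R]_d)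
    (hA : is_system A) (hirr : irreducible A)
    (M : set 'cV[R]_d) (hMconv : convex_set M) (hM : invariant_set A M) :
  ((d = 1%N -> ~ (exists B : 'M[R]_d, A = [set B])) -> M 0) /\
  (M 0 -> interior M 0 \/ conical_point M 0).
Proof.
have [A0 _ _ _] := hA; have [M0 cptM M_neq0 _] := hM.
have AM := invariant_set_flow hM.
split=> [hd|M00]; first exact: (invariant_contains_origin A0 hirr cptM hMconv M0 AM hd).
exact: (invariant_origin_dichotomy hirr cptM hMconv M_neq0 M00 AM).
Qed.
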